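(* Consider the linear system $$D_H x = \big(B(\theta-\theta')\big)_{V_H}-\Delta_H,\qquad x\in\mathbb R^{E_H}, \qquad (\ast)$$ whose right-hand side is known when $\theta'$ and $\Delta_H$ are known. The set $F$ of failed links within the attacked area $H$ can be localized correctly in each of the following cases: 1. If $H$ is acyclic (a tree or a set of trees), then $(\ast)$ has a unique solution $x$, and $\mathrm{supp}(x)=F$. 2. If $H$ is a planar graph such that (i) for every cycle $C$ in $H$ (viewed as a set of links), $|C\cap F|<|C\setminus F|$, and (ii) $F^*$ is $H^*$-separable, then the optimization problem $\min\|x\|_1$ subject to $(\ast)$ has a unique solution $x$, and $\mathrm{supp}(x)=F$.
   Context: Let $G=(V,E)$ be a finite connected simple undirected graph (the power grid); each link $(s,t)\in E$ has a reactance $r_{st}=r_{ts}\neq 0$. The admittance matrix $B=(b_{uv})_{u,v\in V}$ of $G$ has $b_{uv}=-1/r_{uv}$ if $u\ne v$ and $(u,v)\in E$, $b_{uv}=0$ if $u\neq v$ and $(u,v)\notin E$, and $b_{uu}=-\sum_{w\in V\setminus\{u\}}b_{uw}$. Before the attack, the phase angles $\theta\in\mathbb R^V$ and active power injections $p\in\mathbb R^V$ satisfy $B\theta=p$. The attacked area $H=(V_H,E_H)$ is the subgraph of $G$ induced by $V_H\subseteq V$; the attack disconnects a nonempty set $F\subseteq E_H$ of links. After the attack, $\theta',p'\in\mathbb R^V$ satisfy $B'\theta'=p'$, where $B'$ is the admittance matrix of $(V,E\setminus F)$ with the same reactances (the post-attack grid need not be connected). Put $\Delta:=p-p'$ and $\Delta_H:=(\Delta_v)_{v\in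 V_H}$. For a vector $y$ indexed by $V$, $y_{V_H}$ is its restriction to $V_H$. $D_H\in\{-1,0,1\}^{V_H\times E_H}$ is the incidence matrix of $H$ for an arbitrary fixed orientation of links: the entry for node $v$ and link $e$ is $1$ if $e$ comes out of $v$, $-1$ if $e$ goes into $v$, and $0$ otherwise. $\mathrm{supp}(x)$ is the set of indices of nonzero entries of $x$. Standing assumption: $\theta'_s\ne\theta'_t$ for every link $(s,t)\in E_H$. For planar $H$ (with a fixed planar embedding), $H^*$ is the dual graph of $H$ (a multigraph, possibly with loops), and $F^*$ is the set of edges of $H^*$ dual to the links of $F$, i.e. each edge in $F^*$ connects the vertices of $H^*$ corresponding to the two faces of $H$ separated by a failed link. $F^*$ is called $H^*$-separable if there exist pairwise edge-disjoint cycles in $H^*$ (a loop, or a pair of parallel edges, counts as a cycle) such that every edge of $F^*$ lies on one of these cycles and each of these cycles contains exactly one edge of $F^*$. *)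

(* Defs.v *)
From HB Require Import structures.
From mathcomp Require Import all_boot all_order all_algebra.
From mathcomp Require Import all_classical all_reals all_analysis.

Set Implicit Arguments.
Unset Strict Implicit.
Unset Printing Implicit Defensive.

Import Order.TTheory GRing.Theory Num.Theory.
Import numFieldNormedType.Exports.

Local Open Scope ring_scope.

(** Vectors and matrices indexed by arbitrary finite types. *)

Definition mulmf (R : pzRingType) (I J : finType) (A : I -> J -> R)
    (y : {ffun J -> R}) : {ffun I -> R} :=
  [ffun i => \sum_j A i j * y j].

Definition subvec (R : Type) (I : finType) (A : {set I}) (y : {ffun I -> R}) :
    {ffun {i | i \in A} -> R} :=
  [ffun i => y (val i)].

(* The support is returned as a set in the ambient type [I]. *)
Definition supp (R : nmodType) (I : finType) (A : {set I})
    (x : {ffun {i | i \in A} -> R}) : {set I} :=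
  [set val i | i : {i | i \in A} & x i != 0].

Definition norm1 (R : numDomainType) (I : finType) (x : {ffun I -> R}) : R :=
  \sum_i `|x i|.

(** A link is the set of its two end nodes, so that a simple undirected graph
    on [V] is given by a set of two-element sets. *)

Definition simple_links (V : finType) (E : {set {set V}}) : Prop :=
  forall l, l \in E -> #|l| = 2%N.

Definition connected_graph (V : finType) (E : {set {set V}}) : Prop :=
  forall s t : V, connect (fun u v => [set u; v] \in E) s t.

Definition induced_links (V : finType) (E : {set {set V}}) (W : {set V}) :
    {set {set V}} :=
  [set l in E | l \subset W].

Definition admittance_off (R : fieldType) (V : finType) (E : {set {set V}})
    (r : V -> V -> R) (u v : V) : R :=
  if [set u; v] \in E then - (r u v)^-1 else 0.

Definition admittance (R : fieldType) (V : finType) (E : {set {set V}})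
    (r : V -> V -> R) (u v : V) : R :=
  if u == v then - \sum_(w | w != u) admittance_off E r u w
  else admittance_off E r u v.

(* An orientation is given by the node out of which each link comes. *)
Definition is_orientation (V : finType) (L : {set {set V}})
    (tail : {set V} -> V) : Prop :=
  forall l, l \in L -> tail l \in l.

Definition incidence (R : pzRingType) (V : finType) (W : {set V})
    (L : {set {set V}}) (tail : {set V} -> V)
    (v : {v | v \in W}) (l : {l | l \in L}) : R :=
  if val v == tail (val l) then 1 else if val v \in val l then -1 else 0.

(** Cycles of a multigraph with node type [T] and edge type [L], where
    [joins e a b] means that [a] and [b] are the two (possibly equal) ends of
    the edge [e]. A cycle of length 1 is a loop, and a cycle of length 2 is a
    pair of parallel edges. *)

Definition is_cycle (T : Type) (L : finType) (joins : L -> T -> T -> Prop)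
    (C : {set L}) : Prop :=
  exists (k : nat) (v : 'I_k.+1 -> T) (e : 'I_k.+1 -> L),
    [/\ injective v, injective e,
        forall i, joins (e i) (v i) (v (ordS i))
      & C = [set e i | i : 'I_k.+1]].

Definition joins_nodes (V : finType) (L : {set {set V}})
    (l : {set V}) (s t : V) : Prop :=
  l \in L /\ l = [set s; t].

Definition is_graph_cycle (V : finType) (L C : {set {set V}}) : Prop :=
  is_cycle (joins_nodes L) C.

Definition acyclic_graph (V : finType) (L : {set {set V}}) : Prop :=
  forall C, ~ is_graph_cycle L C.

(** Planar embeddings of the graph with node set [W] and link set [L]: links
    are drawn as simple arcs that meet only at common end nodes. *)

Section Planar.
Local Open Scope classical_set_scope.

Record planar_embedding (R : realType) (V : finType) (W : {set V})
    (L : {set {set V}}) := PlanarEmbedding {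
  node_point : V -> R * R;
  link_arc : {set V} -> R -> R * R;
  node_point_inj : {in W &, injective node_point};
  link_arc_continuous : forall l, l \in L ->
    {within `[0, 1], continuous (link_arc l)};
  link_arc_inj : forall l, l \in L -> {in `[0, 1]%R &, injective (link_arc l)};
  link_arc_ends : forall l, l \in L ->
    [set link_arc l 0; link_arc l 1] = node_point @` [set` l];
  link_arc_avoids_nodes : forall l (t : R) v, l \in L -> t \in `]0, 1[%R -> v \in W ->
    link_arc l t <> node_point v;
  link_arc_disjoint : forall l m (s t : R), l \in L -> m \in L -> l != m ->
    s \in `]0, 1[%R -> t \in `]0, 1[%R -> link_arc l s <> link_arc m t
}.

Definition drawing (R : realType) (V : finType) (W : {set V})
    (L : {set {set V}}) (phi : planar_embedding R W L) : set (R * R) :=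
  (node_point phi @` [set` W]) `|`
  \bigcup_(l in [set` L]) (link_arc phi l @` `[0, 1]).

Definition is_face (R : realType) (V : finType) (W : {set V})
    (L : {set {set V}}) (phi : planar_embedding R W L) (A : set (R * R)) : Prop :=
  exists2 z, (~` drawing phi) z & A = connected_component (~` drawing phi) z.

Definition borders (R : realType) (V : finType) (W : {set V})
    (L : {set {set V}}) (phi : planar_embedding R W L)
    (l : {set V}) (A : set (R * R)) : Prop :=
  is_face phi A /\ link_arc phi l @` `]0, 1[ `<=` closure A.

(* The dual graph has the faces as nodes and one edge for each link [l], which
   is identified with [l]; it is a loop when the same face lies on both sides
   of [l]. *)
Definition joins_faces (R : realType) (V : finType) (W : {set V})
    (L : {set {set V}}) (phi : planar_embedding R W L)
    (l : {set V}) (A B : set (R * R)) : Prop :=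
  l \in L /\ [set X | borders phi l X] = [set A; B].

End Planar.

Definition is_dual_cycle (R : realType) (V : finType) (W : {set V})
    (L : {set {set V}}) (phi : planar_embedding R W L) (C : {set {set V}}) : Prop :=
  is_cycle (joins_faces phi) C.

Definition dual_separable (R : realType) (V : finType) (W : {set V})
    (L : {set {set V}}) (phi : planar_embedding R W L) (F : {set {set V}}) : Prop :=
  exists P : {set {set {set V}}},
    [/\ finset.trivIset P,
        forall C, C \in P -> is_dual_cycle phi C,
        F \subset finset.cover P
      & forall C, C \in P -> #|C :&: F| = 1%N].

Definition is_norm1_minimizer (R : numDomainType) (I : finType)
    (S : {ffun I -> R} -> Prop) (x : {ffun I -> R}) : Prop :=
  S x /\ forall y, S y -> norm1 x <= norm1 y.

(* Main.v *)
(** The right-hand side of the system is [(B' - B) theta'] restricted to [VH],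
    so the pre-failure flows of the failed links (computed with [theta'], up to
    sign) form a solution [x0] supported exactly on [F]. Two solutions differ
    by a circulation [z] of [H]. If [z] is nonzero, then following the flow
    from node to node yields a cycle of [H] along which [z] is positive. Hence
    there are no nonzero circulations when [H] is acyclic. In general, peeling
    off such cycles writes [|z|] as a positive combination of characteristic
    vectors of cycles, so a strict majority of links outside [F] on every cycle
    implies [\sum_(F) |z| < \sum_(~ F) |z|], and this is the null space
    property making [x0] the unique minimizer of the 1-norm. *)

Require Import Defs.
From HB Require Import structures.
From mathcomp Require Import all_boot all_order all_algebra.
From mathcomp Require Import all_classical all_reals all_analysis.
From mathcomp Require Import ring.

Set Implicit Arguments.
Unset Strict Implicit.
Unset Printing Implicit Defensive.

Import Order.TTheory GRing.Theory Num.Theory.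

Local Open Scope ring_scope.

(** * Cycles in finite relations *)

(** Iterating a choice of successors gives an infinite walk, which must revisit a node; the stretch
    closed by its first repetition is a cycle. *)
Lemma exists_rel_cycle (V : finType) (e : rel V) (u0 v0 : V) :
    e u0 v0 -> (forall u v, e u v -> exists w, e v w) ->
  exists (k : nat) (v : 'I_k.+1 -> V),
    injective v /\ forall i, e (v i) (v (ordS i)).
Proof.
move=> e0 next_ex.
pose next v := odflt v [pick w | e v w].
have nextP u v : e u v -> e v (next v).
  move=> /next_ex[w evw]; rewrite /next; case: pickP => [//|/(_ w)].
  by rewrite evw.
pose s n := iter n next v0.
have s_step n : e (s n) (s n.+1).
  suff [u us] : exists u, e u (s n) by exact: nextP us.
  by elim: n => [|n [u us]]; [exists u0 | exists (s n); exact: nextP us].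
have repeats : exists n, [exists m : 'I_n, s m == s n].
  apply: contrapT => no_repeat.
  have s_inj : injective (fun i : 'I_#|V|.+1 => s i).
    move=> i j sij; apply/val_inj; case: (ltngtP i j) => // lt_ij.
    - by case: no_repeat; exists j; apply/existsP; exists (Ordinal lt_ij); apply/eqP.
    - by case: no_repeat; exists i; apply/existsP; exists (Ordinal lt_ij); apply/eqP.
  by have := leq_card _ s_inj; rewrite card_ord ltnn.
case: (ex_minnP repeats) => n /existsP[m /eqP s_mn] n_min.
have s_inj i j : (i < n)%N -> (j < n)%N -> s i = s j -> i = j.
  move=> lt_in lt_jn sij; case: (ltngtP i j) => // lt_ij.
  - suff: (n <= j)%N by rewrite leqNgt lt_jn.
    by apply: n_min; apply/existsP; exists (Ordinal lt_ij); apply/eqP.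
  - suff: (n <= i)%N by rewrite leqNgt lt_in.
    by apply: n_min; apply/existsP; exists (Ordinal lt_ij); apply/eqP.
have lt_mn := ltn_ord m.
(* The cycle is [s m], ..., [s (n - 1)], of length [n - m = k.+1]; at the last index [ordS] wraps
   around, and [s n = s m] closes it. *)
pose k := (n - m).-1.
have nE : n = (m + k.+1)%N by rewrite prednK ?subn_gt0// subnKC// ltnW.
exists k, (fun i => s (m + i)%N); split.
  have lt_n (i : 'I_k.+1) : (m + i < n)%N by rewrite [ltnRHS]nE ltn_add2l.
  by move=> i j /(s_inj _ _ (lt_n i) (lt_n j)) /addnI /val_inj.
move=> i; have := s_step (m + i)%N; rewrite -addnS /=.
have [lt_ik|] := ltnP i.+1 k.+1; first by rewrite modn_small.
move=> le_ki; have -> : i.+1 = k.+1 by apply/eqP; rewrite eqn_leq le_ki ltn_ord.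
by rewrite modnn addn0 -nE -s_mn.
Qed.

(** * Circulations and their cycles *)

(** Since links have two distinct ends, a link at [u] corresponds to exactly one neighbour [v]. *)
Lemma sum_links_at (R : nmodType) (V : finType) (L : {set {set V}}) (u : V)
    (G : {set V} -> R) : simple_links L ->
  \sum_(l in L | u \in l) G l = \sum_(v | [set u; v] \in L) G [set u; v].
Proof.
move=> L_simple; pose N := finset [pred v | [set u; v] \in L].
have neq v : [set u; v] \in L -> u != v.
  by move=> /L_simple; rewrite cards2; case: (u == v).
transitivity (\sum_(l in [set [set u; v] | v in N]) G l).
  apply: eq_bigl => l; apply/andP/imsetP => [[lL ul]|[v + ->]]; last first.
    by rewrite inE /= => uvL; rewrite uvL !inE eqxx.
  move/eqP/cards2P: (L_simple _ lL) => [a [b [_ lE]]].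
  move: lL ul; rewrite lE => lL; rewrite !inE => /orP[]/eqP uE.
    by exists b; rewrite ?[_ \in N]inE /= uE.
  by exists a; rewrite ?[_ \in N]inE /= uE finset.setUC.
rewrite big_imset /=; first by apply: eq_bigl => v; rewrite inE.
move=> v w; rewrite !inE /= => vN wN eq_vw.
have : v \in [set u; w] by rewrite -eq_vw !inE eqxx orbT.
by rewrite !inE eq_sym (negPf (neq _ vN)) => /eqP.
Qed.

(* [incidence] with its indices extended to all nodes and all sets of nodes. *)
Definition incid (R : pzRingType) (V : finType) (tail : {set V} -> V) (u : V)
    (l : {set V}) : R :=
  if u == tail l then 1 else if u \in l then -1 else 0.

Definition circulation (R : pzRingType) (V : finType) (L : {set {set V}})
    (tail : {set V} -> V) (z : {set V} -> R) : Prop :=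
  forall u, \sum_(l in L) incid R tail u l * z l = 0.

Section Circulations.
Context {R : realDomainType} {V : finType}.
Context (L : {set {set V}}) (tail : {set V} -> V).
Context (L_simple : simple_links L) (tail_orients : is_orientation L tail).
Local Notation incid := (incid R tail).

Lemma link_neq u v : [set u; v] \in L -> u != v.
Proof. by move=> /L_simple; rewrite cards2; case: (u == v). Qed.

Lemma incid_out u l : l \in L -> u \notin l -> incid u l = 0.
Proof.
move=> /tail_orients tl ul; rewrite /incid (negPf ul).
by case: eqP => // uE; rewrite uE tl in ul.
Qed.

Lemma incid_tail_or_head u v : [set u; v] \in L ->
  (incid u [set u; v] = 1 /\ incid v [set u; v] = -1) \/
  (incid u [set u; v] = -1 /\ incid v [set u; v] = 1).
Proof.
move=> uvL; have neq_uv := link_neq uvL.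
have := tail_orients uvL; rewrite /incid !inE !eqxx !orbT /=.
move=> /orP[]/eqP ->; rewrite eqxx.
  by left; rewrite eq_sym (negPf neq_uv).
by right; rewrite (negPf neq_uv).
Qed.

Lemma incidN u v : [set u; v] \in L ->
  incid v [set u; v] = - incid u [set u; v].
Proof. by move=> /incid_tail_or_head[] [-> ->]; rewrite ?opprK. Qed.

Lemma sum_incid_at (z : {set V} -> R) u :
  \sum_(l in L) incid u l * z l =
  \sum_(v | [set u; v] \in L) incid u [set u; v] * z [set u; v].
Proof.
rewrite -(sum_links_at _ (fun l => incid u l * z l)) //.
rewrite [LHS](bigID (fun l : {set V} => u \in l)) /= [X in _ + X]big1 ?addr0 //.
by move=> l /andP[lL ul]; rewrite incid_out ?mul0r.
Qed.

(** Conservation at each node lets flow that enters leave again, so the relation of carrying flow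
    from one node to the next has no dead end. *)
Lemma circulation_cycle (z : {set V} -> R) l0 :
    circulation L tail z -> l0 \in L -> z l0 != 0 ->
  exists (k : nat) (v : 'I_k.+1 -> V), injective v /\ forall i,
    let l := [set v i; v (ordS i)] in l \in L /\ 0 < incid (v i) l * z l.
Proof.
move=> z_circ l0L z_neq0.
pose e u v := ([set u; v] \in L) && (0 < incid u [set u; v] * z [set u; v]).
have [u0 [v0 e0]] : exists u v, e u v.
  move/eqP/cards2P: (L_simple l0L) => [a [b [_ l0E]]].
  have abL : [set a; b] \in L by rewrite -l0E.
  move: z_neq0; rewrite l0E neq_lt => /orP[] z_sign;
    case: (incid_tail_or_head abL) => -[ia ib].
  - by exists b, a; rewrite /e finset.setUC abL ib mulN1r oppr_gt0.
  - by exists a, b; rewrite /e abL ia mulN1r oppr_gt0.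
  - by exists a, b; rewrite /e abL ia mul1r.
  - by exists b, a; rewrite /e finset.setUC abL ib mul1r.
have next u v : e u v -> exists w, e v w.
  move=> /andP[uvL uv_gt0]; apply: contrapT => no_next.
  (* Without a next node, the balance at [v] has only nonpositive terms, and that of [u] is
     negative. *)
  have := z_circ v; rewrite sum_incid_at; apply/eqP.
  have vuL : [set v; u] \in L by rewrite finset.setUC.
  rewrite (bigD1 u) //= lt_eqF // -[X in _ < X]addr0 ltr_leD //.
    by rewrite finset.setUC incidN // mulNr oppr_lt0.
  apply: sumr_le0 => w /andP[vwL _]; rewrite leNgt; apply/negP => vw_gt0.
  by apply: no_next; exists w; rewrite /e vwL.
have [k [v [v_inj ve]]] := exists_rel_cycle e0 next.
by exists k, v; split=> // i; apply/andP/ve.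
Qed.

(* The cycle follows the direction of the flow [z], so that subtracting a
   multiple of its signed characteristic vector can be done without sign
   changes. *)
Lemma circulation_conformal_cycle (z : {set V} -> R) l0 :
    circulation L tail z -> l0 \in L -> z l0 != 0 ->
  exists C, [/\ is_graph_cycle L C, C \subset L,
    forall l, l \in C -> z l != 0 &
    circulation L tail (fun l => if l \in C then Num.sg (z l) else 0)].
Proof.
move=> z_circ l0L /(circulation_cycle z_circ l0L)[k [v [v_inj v_pos]]].
pose e i := [set v i; v (ordS i)].
have eL i : e i \in L by case: (v_pos i).
have e_pos i : 0 < incid (v i) (e i) * z (e i) by case: (v_pos i).
(* Two distinct indices with the same link would traverse it in opposite directions, but the flow is
   positive in only one. *)
have e_inj : injective e.
  move=> i j eij; apply: v_inj.
  have : v i \in e j by rewrite -eij !inE eqxx.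
  rewrite !inE => /orP[/eqP//|/eqP vij].
  have := e_pos i; rewrite eij vij /e incidN ?mulNr ?oppr_gt0; last exact: eL.
  by move=> /ltW; rewrite leNgt e_pos.
exists [set e i | i : 'I_k.+1]; split.
- by exists k, v, e; split=> // i; split.
- by apply/fintype.subsetP => l /imsetP[i _ ->].
- move=> l /imsetP[i _ ->]; apply: contraTneq (e_pos i) => ->.
  by rewrite mulr0 ltxx.
move=> u; transitivity
    (\sum_(l in [set e i | i : 'I_k.+1]) incid u l * Num.sg (z l)).
  rewrite big_mkcond [RHS]big_mkcond /=; apply: eq_bigr => l _.
  case: imsetP => [[i _ ->]|_]; first by rewrite eL.
  by rewrite mulr0 if_same.
rewrite big_imset /=; last by move=> i j _ _; exact: e_inj.
have sgE i : Num.sg (z (e i)) = incid (v i) (e i).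
  have := e_pos i; case: (incid_tail_or_head (eL i)) => -[-> _].
    by rewrite mul1r => /gtr0_sg.
  by rewrite mulN1r oppr_gt0 => /ltr0_sg.
(* Link [e i] adds 1 at its start [v i] and subtracts 1 at [v (ordS i)]; the sum vanishes because
   [ordS] is a permutation. *)
transitivity (\sum_(i < k.+1) ((u == v i)%:R - (u == v (ordS i))%:R) : R).
  apply: eq_bigr => i _; rewrite sgE.
  have := link_neq (eL i).
  have [-> neq_v|neq_i _] := eqVneq u (v i).
    rewrite (negPf neq_v) subr0.
    by case: (incid_tail_or_head (eL i)) => -[-> _]; rewrite ?mulrNN mulr1.
  have [->|neq_i'] := eqVneq u (v (ordS i)).
    rewrite sub0r.
    by case: (incid_tail_or_head (eL i)) => -[-> ->]; rewrite ?mulr1 ?mulrN1 ?mul1r.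
  by rewrite incid_out ?mul0r ?subr0 // !inE negb_or neq_i.
rewrite sumrB [X in X - _](reindex_inj (@ordS_inj k.+1)) /=.
by rewrite subrr.
Qed.

Lemma acyclic_circulation0 (z : {set V} -> R) :
  acyclic_graph L -> circulation L tail z -> forall l, l \in L -> z l = 0.
Proof.
move=> L_acyclic z_circ l lL; apply: contrapT => /eqP.
move=> /(circulation_conformal_cycle z_circ lL)[C [C_cycle _ _ _]].
exact: L_acyclic C_cycle.
Qed.

(** Induction on the size of the support. Subtracting along a conformal cycle the least [|z|] on it
    lowers the two sums in proportion to [#|C :&: F|] and [#|C :\: F|], which the hypothesis
    compares. *)
Lemma circulation_sum_lt (z : {set V} -> R) (F : {set {set V}}) :
    (forall C, is_graph_cycle L C -> (#|C :&: F| < #|C :\: F|)%N) ->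
    circulation L tail z -> (exists2 l, l \in L & z l != 0) ->
  \sum_(l in L | l \in F) `|z l| < \sum_(l in L | l \notin F) `|z l|.
Proof.
move=> cycles_lt.
have [n] := ubnP #|[set l in L | z l != 0]|.
elim: n z => // n IHn z; rewrite ltnS => supp_z z_circ [l0 l0L z_l0].
have [C [C_cycle CL z_C sg_circ]] := circulation_conformal_cycle z_circ l0L z_l0.
have [l1 l1C] : exists l, l \in C.
  by case: C_cycle => k [v [e [_ _ _ ->]]]; exists (e ord0); exact: imset_f.
have [lm lmC lm_min] := @arg_minP _ _ _ l1 [in C] (fun l => `|z l|) l1C.
move: (lmC : lm \in C) => {}lmC.
(* The minimum over [C] is the largest multiple that reverses no sign, and it removes [lm] from the
   support. *)
pose lam := `|z lm|.
have lam_gt0 : 0 < lam by rewrite normr_gt0 z_C.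
pose z' l := z l - lam * (if l \in C then Num.sg (z l) else 0).
have z'_circ : circulation L tail z'.
  move=> u; under eq_bigr do rewrite mulrBr mulrCA.
  by rewrite sumrB -mulr_sumr z_circ sg_circ mulr0 subr0.
have z'_norm l : `|z' l| = `|z l| - lam * (l \in C)%:R.
  rewrite /z'; case: ifP => lC; last by rewrite !mulr0 !subr0.
  rewrite mulr1 {1}[z l]numEsg mulrC -mulrBl normrM normr_sg z_C // mulr1.
  by rewrite ger0_norm // subr_ge0 lm_min.
have sum_z (P : pred {set V}) : \sum_(l in L | P l) `|z l| =
    \sum_(l in L | P l) `|z' l| + lam * #|[set l in C | P l]|%:R.
  apply/eqP; rewrite -subr_eq0 opprD addrA -sumrB; apply/eqP.
  under eq_bigr do rewrite z'_norm opprB addrC subrK.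
  rewrite -mulr_sumr -mulrBr [X in _ * (X - _)](_ : _ = #|[set l in C | P l]|%:R).
    by rewrite subrr mulr0.
  rewrite -sum1_card natr_sum big_mkcond [RHS]big_mkcond /=.
  apply: eq_bigr => l _; rewrite inE; case: (P l); rewrite ?andbF ?andbT //.
  have := fintype.subsetP CL l.
  by case: (l \in C) => [->|_] //; case: ifP.
rewrite !sum_z.
have -> : [set l in C | l \in F] = C :&: F by apply/finset.setP => l; rewrite !inE.
have -> : [set l in C | l \notin F] = C :\: F.
  by apply/finset.setP => l; rewrite !inE andbC.
(* Strictness comes from the removed cycle; the remainder may be zero, so only [<=] is asked of
   it. *)
apply: ler_ltD; last by rewrite ltr_pM2l // ltr_nat cycles_lt.
have [|z'0] := pselect (exists2 l, l \in L & z' l != 0).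
  move=> z'_neq0; apply/ltW/IHn => //.
  apply: leq_trans supp_z; apply: proper_card; apply/properP; split.
    apply/fintype.subsetP => l; rewrite !inE => /andP[-> /=].
    by apply: contra_neq => z0; rewrite /z' z0 sgr0 if_same mulr0 subr0.
  exists lm; first by rewrite inE (fintype.subsetP CL) // z_C.
  rewrite inE negb_and negbK -normr_eq0 z'_norm lmC mulr1 subrr eqxx.
  exact: orbT.
rewrite !big1 // => l /andP[lL _]; apply/eqP; rewrite normr_eq0.
  by apply: contrapT => /negP h; apply: z'0; exists l.
by apply: contrapT => /negP h; apply: z'0; exists l.
Qed.

End Circulations.

(** * Admittance matrices and the flows of failed links *)

Lemma mulmfB (R : pzRingType) (I J : finType) (A : I -> J -> R)
    (y z : {ffun J -> R}) : mulmf A (y - z) = mulmf A y - mulmf A z.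
Proof.
apply/ffunP => i; rewrite !ffunE -sumrB.
by apply: eq_bigr => j _; rewrite !ffunE mulrBr.
Qed.

(** This is the Laplacian form, valid since rows sum to zero: each link contributes separately, so
    deleting links just deletes terms. *)
Lemma mulmf_admittance (R : fieldType) (V : finType) (E : {set {set V}})
    (r : V -> V -> R) (y : {ffun V -> R}) (u : V) : simple_links E ->
  mulmf (admittance E r) y u =
  \sum_(v | [set u; v] \in E) (r u v)^-1 * (y u - y v).
Proof.
move=> E_simple; rewrite ffunE (bigD1 u) //= {1}/admittance eqxx mulNr mulr_suml.
rewrite -sumrN -big_split [RHS]big_mkcond /= big_mkcond.
apply: eq_bigr => v _; rewrite /admittance /admittance_off eq_sym.
have [->|neq_vu] := eqVneq v u; last by case: ifP => _; ring.
by case: ifP => // /(link_neq E_simple); rewrite eqxx.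
Qed.

(* The minus sign is that of the right-hand side of the system, which is the
   restriction to [VH] of [(B' - B) theta']. The inner sum has a single term,
   for the head of the link. *)
Definition failed_flow (R : fieldType) (V : finType) (r : V -> V -> R)
    (F : {set {set V}}) (theta' : V -> R) (tail : {set V} -> V) (l : {set V}) : R :=
  if l \in F then
    - \sum_(v in l :\ tail l) (r (tail l) v)^-1 * (theta' (tail l) - theta' v)
  else 0.

Section FailedFlow.
Context {R : realFieldType} {V : finType}.
Context (E F : {set {set V}}) (r : V -> V -> R) (theta' : {ffun V -> R}).
Context (L : {set {set V}}) (tail : {set V} -> V).
Context (E_simple : simple_links E).
Context (r_sym : forall s t, [set s; t] \in E -> r s t = r t s).
Context (r_neq0 : forall s t, [set s; t] \in E -> r s t != 0).
Context (LE : L \subset E) (FL : F \subset L).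
Context (theta'_neq : forall s t, [set s; t] \in L -> theta' s != theta' t).
Context (tail_orients : is_orientation L tail).
Local Notation flow := (failed_flow r F theta' tail).

Lemma link_tail_head l : l \in L ->
  exists h, [/\ l = [set tail l; h], tail l != h & l :\ tail l = [set h]].
Proof.
move=> lL; have lE := fintype.subsetP LE l lL.
move/eqP: (E_simple lE) => l2; have tl := tail_orients lL.
move: l2; rewrite (cardsD1 (tail l)) tl => /cards1P[h hE]; exists h.
have lhE : l = [set tail l; h] by rewrite -[LHS](finset.setD1K tl) hE.
by split=> //; apply: (link_neq E_simple); rewrite -lhE.
Qed.

(** The flow of a failed link is, up to sign, a nonzero phase difference over a nonzero
    reactance. *)
Lemma failed_flow_neq0 l : l \in L -> (flow l != 0) = (l \in F).
Proof.
move=> lL; rewrite /failed_flow; case: ifP => _; last by rewrite eqxx.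
have [h [lE _ ->]] := link_tail_head lL.
rewrite big_set1 oppr_eq0 mulf_neq0 ?subr_eq0 ?theta'_neq -?lE //.
by rewrite invr_eq0 r_neq0 // -lE (fintype.subsetP LE).
Qed.

(** Reversing a link changes the sign of both factors, so the product is independent of [tail]. *)
Lemma incid_failed_flow u v : [set u; v] \in F ->
  incid R tail u [set u; v] * flow [set u; v] =
  - ((r u v)^-1 * (theta' u - theta' v)).
Proof.
move=> uvF; have uvL := fintype.subsetP FL _ uvF.
have uvE := fintype.subsetP LE _ uvL.
have neq_uv := link_neq E_simple uvE.
have := tail_orients uvL; rewrite /failed_flow uvF !inE /incid.
move=> /orP[]/eqP tE; rewrite tE.
  rewrite eqxx mul1r (_ : _ :\ u = [set v]) ?big_set1 //.
  by apply/finset.setP => w; rewrite !inE; case: eqVneq => // ->; rewrite (negPf neq_uv).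
rewrite (negPf neq_uv) !inE eqxx /= (_ : _ :\ v = [set u]) ?big_set1.
  by rewrite (r_sym uvE); ring.
apply/finset.setP => w; rewrite !inE; case: eqVneq => [->|]; last by rewrite orbF.
by rewrite eq_sym (negPf neq_uv).
Qed.

(** Surviving links contribute equally to both Laplacians and cancel; only the terms of [F]
    remain. *)
Lemma sum_incid_failed_flow u :
  \sum_(l in L) incid R tail u l * flow l =
  mulmf (admittance (E :\: F) r) theta' u - mulmf (admittance E r) theta' u.
Proof.
have L_simple : simple_links L.
  by move=> l lL; apply/E_simple/(fintype.subsetP LE).
have EF_simple : simple_links (E :\: F).
  by move=> l; rewrite inE => /andP[_ /E_simple].
rewrite !mulmf_admittance // sum_incid_at // big_mkcond.
rewrite [X in X - _]big_mkcond [X in _ - X]big_mkcond -sumrB /=.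
apply: eq_bigr => v _; rewrite finset.in_setD.
have [uvF|uvF] := boolP ([set u; v] \in F).
  have uvL := fintype.subsetP FL _ uvF.
  by rewrite uvL (fintype.subsetP LE _ uvL) incid_failed_flow // sub0r.
by rewrite subrr /failed_flow (negPf uvF) mulr0 if_same.
Qed.

End FailedFlow.

(** * Comparing solutions in the 1-norm *)

Section Extension.
Context {R : realDomainType} {I : finType} (A : {set I}).
Implicit Types x y : {ffun {i | i \in A} -> R}.

(** Solutions are indexed by a subtype, circulations by all sets of nodes; extension by zero
    translates. *)
Definition extend0 x (i : I) : R := if insub i is Some j then x j else 0.

Lemma extend0_val x j : extend0 x (val j) = x j.
Proof. by rewrite /extend0 valK. Qed.

(** On [F], [|x| <= |y| + |y - x|]; off [F], [x] vanishes and [|y| = |y - x|], so the gain of [y]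
    off [F] outweighs its loss on [F]. *)
Lemma norm1_lt_off_support (F : {set I}) x y :
    (forall j, val j \notin F -> x j = 0) ->
    \sum_(i in A | i \in F) `|extend0 (y - x) i| <
    \sum_(i in A | i \notin F) `|extend0 (y - x) i| ->
  norm1 x < norm1 y.
Proof.
move=> x0; rewrite !big_sub_cond /norm1.
under eq_bigr do rewrite extend0_val !ffunE.
under [ltRHS]eq_bigr do rewrite extend0_val !ffunE.
move=> lt_yx; rewrite (bigID (fun j => val j \in F)) /= [X in _ + X]big1 ?addr0.
  rewrite [ltRHS](bigID (fun j => val j \in F)) /=.
  have -> : \sum_(j | val j \notin F) `|y j| = \sum_(j | val j \notin F) `|y j - x j|.
    by apply: eq_bigr => j /x0 ->; rewrite subr0.
  apply: le_lt_trans (_ : \sum_(j | val j \in F) (`|y j| + `|y j - x j|) < _).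
    apply: ler_sum => j _; rewrite -{1}[x j](subKr (y j)).
    exact: ler_normB.
  by rewrite big_split ltrD2l.
by move=> j /x0 ->; rewrite normr0.
Qed.

End Extension.

(** At nodes of [W] the balance is a row of the system; at other nodes no link of [L] ends. *)
Lemma incidence_diff_circulation (R : realDomainType) (V : finType) (W : {set V})
    (L : {set {set V}}) (tail : {set V} -> V) (x y : {ffun {l | l \in L} -> R}) :
    is_orientation L tail -> (forall l, l \in L -> l \subset W) ->
    mulmf (incidence R (W := W) (L := L) tail) x =
    mulmf (incidence R (W := W) (L := L) tail) y ->
  circulation L tail (extend0 (y - x)).
Proof.
move=> tail_orients LW eq_xy u; have [uW|uW] := boolP (u \in W); last first.
  apply: big1 => l lL; rewrite (incid_out tail_orients) ?mul0r //.
  by apply: contraNN uW; apply/fintype.subsetP/LW.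
rewrite big_sub; move/ffunP/(_ (exist _ u uW))/eqP: eq_xy.
rewrite !ffunE eq_sym -subr_eq0 -sumrB => /eqP eq0; rewrite -[RHS]eq0.
by apply: eq_bigr => l _; rewrite extend0_val !ffunE mulrBr.
Qed.

Theorem mainTheorem2 (R : realType) (V : finType) (E : {set {set V}})
    (r : V -> V -> R) (VH : {set V}) (F : {set {set V}})
    (theta p theta' p' : {ffun V -> R}) (tail : {set V} -> V)
    (E_simple : simple_links E)
    (E_connected : connected_graph E)
    (r_sym : forall s t, [set s; t] \in E -> r s t = r t s)
    (r_neq0 : forall s t, [set s; t] \in E -> r s t != 0)
    (F_neq0 : F != finset.set0)
    (F_sub : F \subset induced_links E VH)
    (flow : mulmf (admittance E r) theta = p)
    (flow' : mulmf (admittance (E :\: F) r) theta' = p')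
    (theta'_neq : forall s t, [set s; t] \in induced_links E VH ->
       theta' s != theta' t)
    (tail_orients : is_orientation (induced_links E VH) tail) :
  let EH := induced_links E VH in
  let Delta := p - p' in
  let solves := fun x : {ffun {l | l \in EH} -> R} =>
    mulmf (incidence R (W := VH) (L := EH) tail) x =
    subvec VH (mulmf (admittance E r) (theta - theta')) - subvec VH Delta in
  (acyclic_graph EH ->
   exists x, unique solves x /\ supp x = F) /\
  (forall phi : planar_embedding R VH EH,
   (forall C, is_graph_cycle EH C -> (#|C :&: F| < #|C :\: F|)%N) ->
   dual_separable phi F ->
   exists x, unique (is_norm1_minimizer solves) x /\ supp x = F).
Proof.
move=> EH Delta solves.
have EHE : EH \subset E by apply/fintype.subsetP => l; rewrite inE => /andP[].
have EH_simple : simple_links EH.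
  by move=> l /(fintype.subsetP EHE)/E_simple.
have EH_VH l : l \in EH -> l \subset VH by rewrite inE => /andP[].
pose x0 : {ffun {l | l \in EH} -> R} :=
  [ffun j => failed_flow r F theta' tail (val j)].
have x0_neq0 j : (x0 j != 0) = (val j \in F).
  rewrite ffunE; exact: (failed_flow_neq0 F E_simple r_neq0 EHE theta'_neq
    tail_orients (valP j)).
have x0_solves : solves x0.
  apply/ffunP => -[u uVH].
  have := sum_incid_failed_flow theta' E_simple r_sym EHE F_sub tail_orients u.
  rewrite big_sub => sum_x0.
  transitivity (mulmf (admittance (E :\: F) r) theta' u
                - mulmf (admittance E r) theta' u).
    by rewrite ffunE -sum_x0; apply: eq_bigr => j _; rewrite ffunE.
  (* Unfolding [p] and [p'] cancels the terms in [theta], so only those in [theta'] remain on the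
     right-hand side. *)
  by rewrite /Delta -flow -flow' mulmfB !ffunE; ring.
have x0_supp : supp x0 = F.
  apply/finset.setP => l; apply/imsetP/idP => [[j + ->]|lF].
    by rewrite inE x0_neq0.
  exists (exist _ l (fintype.subsetP F_sub l lF)) => //.
  by rewrite inE x0_neq0.
have diff_circ y : solves y -> circulation EH tail (extend0 (y - x0)).
  by move=> y_solves; apply: (incidence_diff_circulation tail_orients EH_VH);
    rewrite [LHS]x0_solves [RHS]y_solves.
split=> [EH_acyclic|phi cycles_lt _]; exists x0; split=> //.
  split=> // y /diff_circ y_circ; apply/ffunP => j; apply/esym/eqP.
  rewrite -subr_eq0; apply/eqP.
  have := acyclic_circulation0 EH_simple tail_orients EH_acyclic y_circ (valP j).
  by rewrite extend0_val !ffunE.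
(* The strict inequality gives both minimality and uniqueness. *)
have x0_min y : solves y -> y != x0 -> norm1 x0 < norm1 y.
  move=> /diff_circ y_circ neq_y; apply: (norm1_lt_off_support (F := F)).
    by move=> j; rewrite -x0_neq0 negbK => /eqP.
  apply: (circulation_sum_lt EH_simple tail_orients cycles_lt y_circ).
  apply: contrapT => y_eq; move/eqP: neq_y; apply; apply/ffunP => j.
  apply/eqP; apply: contrapT => /negP neq_j; apply: y_eq; exists (val j).
    exact: valP.
  by rewrite extend0_val ffunE [(- x0) j]ffunE subr_eq0.
split.
  split=> // y y_solves; have [->//|neq_y] := eqVneq y x0.
  exact/ltW/x0_min.
move=> y [y_solves y_min]; apply/esym/eqP; apply: contrapT => /negP neq_y.
by have := x0_min y y_solves neq_y; rewrite ltNge y_min.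
Qed.
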